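(* For integers $m,k\ge 0$, let $P_{m,k}=J([m]\times[k])$. Then, as formal power series, \[ \sum_{m=0}^\infty \sum_{k=0}^\infty \d(P_{m,k})\,x^m y^k = \frac{2xy}{(x^2 - 2xy + y^2 - 2x - 2y + 1)^2}. \]
   Context: For a finite poset $P$, $J(P)$ denotes the set of order ideals of $P$ ordered by inclusion (a distributive lattice); $[m]=\{1<2<\dots<m\}$ is a chain and $[m]\times[k]$ carries the componentwise order ($[0]$ is empty, so $J([0]\times[k])$ has one element). For a finite connected graph $G=(V,E)$ with graph distance $\d(p,q)$, the Wiener index is $\d(G)=\sum_{(p,q)\in V\times V}\d(p,q)$ (sum over ordered pairs). For a finite poset $P$, $\d(P)$ denotes the Wiener index of the Hasse diagram of $P$ (vertices are the elements of $P$, edges are the cover relations). *)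

(* Defs.v *)
From mathcomp Require Import all_boot all_order all_algebra.
Set Implicit Arguments. Unset Strict Implicit. Unset Printing Implicit Defensive.
Import GRing.Theory.

Fixpoint reachn (T : finType) (e : rel T) (n : nat) (x y : T) : bool :=
  if n is n'.+1 then (x == y) || [exists z, e x z && reachn e n' z y]
  else x == y.

(* Graph distance: least n with a walk of length <= n from x to y.
   In a connected graph a shortest path has length < #|T|, so searching
   n in 0 .. #|T|-1 gives exactly the graph distance. *)
Definition gdist (T : finType) (e : rel T) (x y : T) : nat :=
  find (fun n => reachn e n x y) (iota 0 #|T|).

Definition wiener (T : finType) (e : rel T) : nat :=
  \sum_(p : T) \sum_(q : T) gdist e p q.

Definition covers (T : finType) (le : rel T) (x y : T) : bool :=
  [&& le x y, x != y &
      ~~ [exists z, [&& le x z, x != z, le z y & z != y]]].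

Definition hasse_adj (T : finType) (le : rel T) : rel T :=
  fun x y => covers le x y || covers le y x.

Definition poset_wiener (T : finType) (le : rel T) : nat :=
  wiener (hasse_adj le).

Definition grid_le (m k : nat) : rel ('I_m * 'I_k) :=
  fun p q => (p.1 <= q.1)%N && (p.2 <= q.2)%N.

Definition is_order_ideal (T : finType) (le : rel T) (A : {set T}) : bool :=
  [forall x in A, forall y, le y x ==> (y \in A)].

Definition Jgrid (m k : nat) : finType :=
  {A : {set 'I_m * 'I_k} | is_order_ideal (@grid_le m k) A}.

Definition Jgrid_le (m k : nat) : rel (Jgrid m k) :=
  fun A B => val A \subset val B.

Definition dP (m k : nat) : nat := poset_wiener (@Jgrid_le m k).

(* A series sum a_{i,j} x^i y^j is represented by its coefficients. *)
Definition fps := nat -> nat -> int.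

Definition fps_mul (f g : fps) : fps :=
  fun m k => (\sum_(i < m.+1) \sum_(j < k.+1) f i j * g (m - i)%N (k - j)%N)%R.

Definition Qden : fps := fun i j =>
  match i, j with
  | 0, 0 => 1%R
  | 1, 0 => (-2)%R
  | 0, 1 => (-2)%R
  | 2, 0 => 1%R
  | 1, 1 => (-2)%R
  | 0, 2 => 1%R
  | _, _ => 0%R
  end.

Definition Nnum : fps := fun i j =>
  match i, j with
  | 1, 1 => 2%R
  | _, _ => 0%R
  end.

Definition Dgen : fps := fun m k => Posz (dP m k).

(* Main.v *)
(* The distance between two ideals in the Hasse diagram of J(P) is the size of
   their symmetric difference.  Ideals of [m] x [k] are lattice paths with
   m + k steps, k of them to the right; counting the symmetric difference along
   the diagonals j - i = const turns it into the sum over t of the difference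
   between the numbers of right steps of the two paths before time t.  Cutting
   the two paths at time t and sorting by this difference d gives
     D = 2 * sum_d d q^d B_d^2,  q = xy,
   where B_d = sum_{i,j} C(i+j+d,i+d) C(i+j+d,i) x^i y^j counts pairs of paths
   of equal length whose ends differ by d.  With s = 1 - x - y, Pascal's rule
   gives the three-term recurrence s B_{d+1} = B_d + q B_{d+2}, which makes
   (B_d) geometric: B_{d+1}^2 = B_d B_{d+2}.  Hence for Q = s^2 - 4q we get
   Q B_0^2 = 1, and Q q^d B_d^2 is q times the second difference of the
   sequence q^d B_d^2, so summation by parts yields Q^2 * sum_d d q^d B_d^2 = q. *)
Require Import Defs.
From HB Require Import structures.
From mathcomp Require Import all_boot all_order all_algebra.
From mathcomp Require Import boolp ring zify.
Set Implicit Arguments. Unset Strict Implicit. Unset Printing Implicit Defensive.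
Import GRing.Theory.

(** * Distance in the lattice of order ideals *)

Section Distance.
Variables (T : finType) (e : rel T).

Lemma reachn_path n x y :
  reachn e n x y <-> exists2 p, path e x p & last x p = y /\ size p <= n.
Proof.
elim: n x => [|n IH] x /=.
  split=> [/eqP<-|[p _ [<-]]]; first by exists [::].
  by rewrite leqn0 size_eq0 => /eqP->.
split=> [/orP[/eqP<-|/existsP[z /andP[exz]]]|].
- by exists [::].
- by case/IH=> p ep [lp sp]; exists (z :: p) => //=; rewrite exz.
case=> -[|z p] /= => [_ [-> _]|/andP[exz ep] [lp sp]]; first by rewrite eqxx.
by apply/orP; right; apply/existsP; exists z; rewrite exz; apply/IH; exists p.
Qed.

Lemma reachn_rcons n x z y : reachn e n x z -> e z y -> reachn e n.+1 x y.
Proof.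
case/reachn_path=> p ep [lp sp] ezy; apply/reachn_path.
by exists (rcons p y); rewrite ?rcons_path ?ep ?lp // last_rcons size_rcons.
Qed.

(** [gdist] searches only below [#|T|]. A walk shortened to one without repeated vertices has fewer
    than [#|T|] steps, so the minimal [n] is in the searched range. *)
Lemma gdistE x y n :
    reachn e n x y -> (forall i, reachn e i x y -> n <= i) ->
  gdist e x y = n.
Proof.
move=> xy_n min_n.
have ltnT : n < #|T|.
  have /reachn_path[p /shortenP[p' ep' up' _] [lp _]] := xy_n.
  have /min_n le_np' : reachn e (size p') x y by apply/reachn_path; exists p'.
  by rewrite (leq_ltn_trans le_np') // -[_.+1](card_uniqP up') max_card.
rewrite /gdist; set P := fun _ => _.
have hasP : has P (iota 0 #|T|) by apply/hasP; exists n; rewrite ?mem_iota.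
have lt_find : find P (iota 0 #|T|) < #|T| by rewrite -[ltnRHS](size_iota 0) -has_find.
apply/eqP; rewrite eqn_leq; apply/andP; split.
  rewrite leqNgt; apply/negP => /(before_find 0); rewrite nth_iota // add0n.
  by rewrite /P xy_n.
by apply: min_n; have := nth_find 0 hasP; rewrite nth_iota.
Qed.
End Distance.

(** * Size of the symmetric difference *)

Section SymmetricDifference.
Variable T : finType.
Implicit Types A B C : {set T}.

Definition symdiff A B : nat := #|A :\: B| + #|B :\: A|.

Lemma symdiffC A B : symdiff A B = symdiff B A.
Proof. exact: addnC. Qed.

Lemma symdiff_eq0 A B : (symdiff A B == 0) = (A == B).
Proof. by rewrite addn_eq0 !cards_eq0 !setD_eq0 -eqEsubset. Qed.

Lemma symdiffU1 x A B : x \in B -> x \notin A ->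
  symdiff A B = (symdiff (x |: A) B).+1.
Proof.
move=> xB xA; rewrite /symdiff -addnS; congr (_ + _).
  by apply: eq_card => z; rewrite !inE; case: eqP => // ->; rewrite xB (negPf xA).
rewrite (cardsD1 x) !inE xB xA add1n; congr _.+1.
by apply: eq_card => z; rewrite !inE negb_or andbA.
Qed.

Lemma symdiffU1_le x A B : x \notin A ->
  symdiff (x |: A) B <= (symdiff A B).+1 <= (symdiff (x |: A) B).+2.
Proof.
move=> xA; have [xB|xB] := boolP (x \in B).
  by rewrite (symdiffU1 xB xA) leqnn leqW.
suff -> : symdiff (x |: A) B = (symdiff A B).+1 by rewrite leqnn /= leqW.
rewrite /symdiff -addSn; congr (_ + _).
  rewrite (cardsD1 x) !inE eqxx xB add1n; congr _.+1.
  by apply: eq_card => z; rewrite !inE; case: eqP => // ->; rewrite (negPf xA) andbF.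
apply: eq_card => z; rewrite !inE; case: eqP => // ->.
by rewrite (negPf xB) !andbF.
Qed.
End SymmetricDifference.

(** * Cover relations and distances between ideals *)

Section IdealLattice.
Variables (T : finType) (le : rel T).
Hypotheses (le_refl : reflexive le) (le_anti : antisymmetric le)
  (le_trans : transitive le).

Let J := {A : {set T} | is_order_ideal le A}.
Let Jle : rel J := fun A B => val A \subset val B.
Implicit Types A B C : J.

Lemma idealP (A : {set T}) :
  reflect (forall x y, le y x -> x \in A -> y \in A) (is_order_ideal le A).
Proof.
apply: (iffP idP) => [/forall_inP idA x y yx xA|idA].
  by have /forallP/(_ y)/implyP := idA x xA; apply.
by apply/forall_inP => x xA; apply/forallP => y; apply/implyP => /idA; apply.
Qed.

(** Take [x] minimal in B minus A: whatever lies strictly below [x] is in B, hence in A by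
    minimality, so adding [x] keeps A an ideal. *)
Lemma add_minimal A B : ~~ (val B \subset val A) ->
  exists x C, [/\ x \in val B, x \notin val A & val C = x |: val A].
Proof.
case/subsetPn=> x0 x0B x0A.
pose P x := (x \in val B) && (x \notin val A).
have Px0 : P x0 by rewrite /P x0B.
(* A smallest principal down-set yields a minimal element: a competitor [y] below [x] has a
   contained, equally large down-set, so [x] is below [y] too. *)
have [x /andP[xB xA] min_x] := arg_minnP (fun x => #|[set y | le y x]|) Px0.
have idC : is_order_ideal le (x |: val A).
  apply/idealP => z y yz /setU1P[ezx|zA]; last first.
    by apply/setU1P; right; have /idealP/(_ z y yz zA) := valP A.
  rewrite {z}ezx in yz; apply/setU1P; have [->|neq_yx] := eqVneq y x; [by left|right].
  apply: contraNT neq_yx => yA.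
  have yB : y \in val B by have /idealP/(_ x y yz xB) := valP B.
  have sub : [set z | le z y] \subset [set z | le z x].
    by apply/subsetP => z; rewrite !inE => /le_trans; apply.
  have Py : P y by rewrite /P yB.
  have /eqP/setP/(_ x) : [set z | le z y] == [set z | le z x].
    by rewrite eqEcard sub min_x.
  by rewrite !inE le_refl => xy; apply/eqP/le_anti; rewrite yz xy.
by exists x, (Sub _ idC : J).
Qed.

Lemma covers_ideal A C :
  covers Jle A C <-> exists2 x, x \notin val A & val C = x |: val A.
Proof.
rewrite /covers /Jle; split=> [/and3P[AC neqAC /existsPn noZ]|[x xA eC]].
  have nCA : ~~ (val C \subset val A).
    by apply: contraNN neqAC => CA; apply/eqP/val_inj/eqP; rewrite eqEsubset AC.
  have [x [Z [xC xA eZ]]] := add_minimal nCA; exists x => //.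
  have := noZ Z; rewrite eZ subsetUr subUset sub1set xC AC /=.
  case: eqVneq => [eAZ|_] /=; first by rewrite eAZ eZ setU11 in xA.
  by rewrite negbK => /eqP <-.
apply/and3P; split; first by rewrite eC subsetUr.
  by apply: contraNneq xA => ->; rewrite eC setU11.
apply/existsPn => Z; apply/negP => /and4P[AZ nAZ ZC nZC].
have [xZ|xZ] := boolP (x \in val Z).
  case/eqP: nZC; apply/val_inj/eqP; rewrite eqEsubset [X in X && _]ZC eC.
  by rewrite subUset sub1set xZ.
case/eqP: nAZ; apply/val_inj/eqP; rewrite eqEsubset [X in X && _]AZ.
apply/subsetP => z zZ; have := subsetP ZC z zZ; rewrite eC => /setU1P[ez|//].
by rewrite -ez zZ in xZ.
Qed.

Lemma hasse_step A B C : hasse_adj Jle A C ->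
  symdiff (val A) (val B) <= (symdiff (val C) (val B)).+1.
Proof.
by case/orP=> /covers_ideal[x xA ->]; have := symdiffU1_le (val B) xA; lia.
Qed.

(** Upper bound: each added minimal element lowers the symmetric difference by one. Lower bound: by
    [hasse_step] no edge lowers it by more. *)
Theorem gdist_ideal A B : gdist (hasse_adj Jle) A B = symdiff (val A) (val B).
Proof.
apply: gdistE => [|n].
  have [n] := ubnP (symdiff (val A) (val B)); elim: n A B => // n IH A B ltn.
  have [BA|nBA] := boolP (val B \subset val A).
    have [AB|nAB] := boolP (val A \subset val B).
      have -> : A = B by apply/val_inj/eqP; rewrite eqEsubset AB.
      by case: symdiff => /= [|k]; rewrite eqxx.
    (* Here B is strictly inside A, so it is B that grows, and the walk is extended at its far
       end. *)
    have [x [C [xA xB eC]]] := add_minimal nAB.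
    move: ltn; rewrite symdiffC (symdiffU1 xA xB) -eC symdiffC => ltn.
    apply: (@reachn_rcons _ _ _ _ C); first exact: IH.
    by apply/orP; right; apply/covers_ideal; exists x.
  have [x [C [xB xA eC]]] := add_minimal nBA.
  move: ltn; rewrite (symdiffU1 xB xA) -eC => ltn /=.
  apply/orP; right; apply/existsP; exists C; rewrite IH // andbT.
  by apply/orP; left; apply/covers_ideal; exists x.
elim: n A => [|n IH] A /=.
  by move/eqP->; rewrite leqn0 symdiff_eq0.
case/orP=> [/eqP->|/existsP[C /andP[AC /IH leCB]]].
  by rewrite (eqP (_ : symdiff _ _ == 0)) // symdiff_eq0.
exact: leq_trans (hasse_step B AC) _.
Qed.
End IdealLattice.

(** * Ideals of a grid as lattice paths *)

Lemma card_ord_interval n a b :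
  b <= n -> #|[set i : 'I_n | a <= i < b]| = b - a.
Proof.
move=> lebn; rewrite -sum1dep_card.
rewrite -(big_mkord (fun i => a <= i < b) (fun=> 1)).
rewrite (eq_bigl (fun i => (true && (i < b)) && (a <= i))).
  rewrite -big_nat_widenl // -big_nat_widen //.
  by rewrite sum_nat_const_nat muln1.
by move=> i; rewrite andbC.
Qed.

Lemma mem_initial_segment n (D : {set 'I_n}) i :
    (forall x y : 'I_n, y <= x -> x \in D -> y \in D) ->
  (i \in D) = (i < #|D|).
Proof.
move=> downD; apply/idP/idP => [iD|].
  rewrite -[i.+1]subn0 -(card_ord_interval 0 (ltn_ord i)).
  by apply/subset_leq_card/subsetP => j; rewrite inE /= ltnS => /downD; apply.
apply: contraTT => niD; rewrite -leqNgt.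
rewrite -[leqRHS]subn0 -(card_ord_interval 0 (ltnW (ltn_ord i))).
apply/subset_leq_card/subsetP => j jD; rewrite inE /= ltnNge.
by apply: contra niD => /downD; apply.
Qed.

(** * Right steps of a path before a given time *)

Section PrefixCount.
Variable n : nat.
Implicit Types W : {set 'I_n}.

Definition prefix_count W t := #|[set s in W | s < t]|.

Lemma prefix_count0 W : prefix_count W 0 = 0.
Proof. by apply/eqP; rewrite cards_eq0; apply/eqP/setP => s; rewrite !inE andbF. Qed.

Lemma prefix_count_full W t : n <= t -> prefix_count W t = #|W|.
Proof.
move=> lent; apply: eq_card => s.
by rewrite inE (leq_trans (ltn_ord s) lent) andbT.
Qed.

Lemma leq_prefix_count W t u : t <= u -> prefix_count W t <= prefix_count W u.
Proof.
move=> letu; apply/subset_leq_card/subsetP => s; rewrite !inE => /andP[-> st].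
exact: leq_trans st letu.
Qed.

Lemma prefix_countS W (s : 'I_n) :
  prefix_count W s.+1 = (s \in W) + prefix_count W s.
Proof.
rewrite /prefix_count (cardsD1 s) !inE ltnSn andbT; congr (_ + _).
by apply: eq_card => u; rewrite !inE -val_eqE /=; case: (u \in W) => /=; lia.
Qed.

Lemma prefix_countD W t d : prefix_count W (t + d) <= prefix_count W t + d.
Proof.
elim: d => [|d IH]; first by rewrite !addn0.
rewrite addnS; have [lttd|lend] := ltnP (t + d) n.
  have := prefix_countS W (Ordinal lttd); rewrite /= => ->.
  by case: (_ \in W); lia.
have : prefix_count W (t + d).+1 = prefix_count W (t + d).
  by rewrite !prefix_count_full // leqW.
lia.
Qed.

Lemma prefix_count_bounds W t : t <= n ->
  [/\ prefix_count W t <= t, prefix_count W t <= #|W|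
    & #|W| <= prefix_count W t + (n - t)].
Proof.
move=> letn; split.
- by have := prefix_countD W 0 t; rewrite prefix_count0 !add0n.
- by apply/subset_leq_card/subsetP => s; rewrite inE => /andP[].
- by rewrite -(prefix_count_full W (leqnn n)) -{1}(subnKC letn) prefix_countD.
Qed.

Lemma prefix_count_inj W W' :
  (forall t, t <= n -> prefix_count W t = prefix_count W' t) -> W = W'.
Proof.
move=> eqc; apply/setP => s; have := prefix_countS W s.
rewrite eqc // eqc ?(ltnW (ltn_ord s)) // prefix_countS.
by move/addIn; case: (s \in W); case: (s \in W').
Qed.

(** Cutting at time [t] splits [W] into an arbitrary [a]-subset of the first [t] times and an
    arbitrary [(k - a)]-subset of the other [n - t]. *)
Lemma card_prefix_count t k a : t <= n -> a <= k ->
  #|[set W : {set 'I_n} | (#|W| == k) && (prefix_count W t == a)]|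
  = 'C(t, a) * 'C(n - t, k - a).
Proof.
move=> letn leak; pose L := [set s : 'I_n | s < t].
have cardL : #|L| = t by rewrite -[RHS]subn0 -(card_ord_interval 0 letn).
have cardCL : #|~: L| = n - t by rewrite cardsCs setCK card_ord cardL.
have countE W : prefix_count W t = #|W :&: L|.
  by apply: eq_card => s; rewrite !inE.
pose f W := (W :&: L, W :\: L).
have f_inj : injective f by move=> W W' [e1 e2]; rewrite -(setID W L) e1 e2 setID.
rewrite -cardCL -[in 'C(t, a)]cardL -!cards_draws -cardsX -(card_imset _ f_inj).
apply: eq_card => -[U V]; rewrite !inE /=; apply/imsetP/idP.
  case=> W; rewrite inE countE => /andP[/eqP cW /eqP ca] [-> ->].
  rewrite subsetIr ca eqxx /= setDE subsetIr /= -setDE.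
  by have := cardsID L W; rewrite cW ca => <-; rewrite addKn.
case/andP=> /andP[UL /eqP cU] /andP[VL /eqP cV].
have VL0 : V :&: L = set0 by apply/eqP; rewrite setI_eq0 disjoints_subset.
have UVL : (U :|: V) :&: L = U by rewrite setIUl (setIidPl UL) VL0 setU0.
have UVD : (U :|: V) :\: L = V.
  rewrite setDUl; have -> : U :\: L = set0 by apply/eqP; rewrite setD_eq0.
  by rewrite set0U setDE (setIidPl VL).
exists (U :|: V); last by rewrite /f UVL UVD.
by rewrite inE countE -(cardsID L) UVL UVD cU cV subnKC // !eqxx.
Qed.
End PrefixCount.

Section GridIdeals.
Variables m k : nat.
Implicit Types W : {set 'I_(m + k)}.

(* [W] is the set of right steps of a path from the top left corner (m, 0) to
   (0, k); cell (i, j) lies below it iff the j-th right step (counted from 0)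
   precedes time j + m - i. *)
Definition below_path W : {set 'I_m * 'I_k} :=
  [set p : 'I_m * 'I_k | p.2 < prefix_count W (p.2 + m - p.1)].

Lemma below_path_ideal W : is_order_ideal (@grid_le m k) (below_path W).
Proof.
apply/idealP => -[i j] [i' j'] /andP[/= lei lej]; rewrite !inE /= => ltj.
have lti := ltn_ord i.
(* Going back [j - j'] time units loses at most [j - j'] right steps, and the time attached to
   [(i', j')] is no earlier than that. *)
have := prefix_countD W (j + m - i - (j - j')) (j - j').
have := @leq_prefix_count _ W (j + m - i - (j - j')) (j' + m - i').
rewrite subnK; last by lia.
move=> h1 h2; have /h1 : j + m - i - (j - j') <= j' + m - i' by lia.
lia.
Qed.

(** Sort the cells by the diagonal [t = j + m - i]. On it a cell is determined by its column [j],
    and it is counted exactly when [prefix_count W' t <= j < prefix_count W t]. *)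
Lemma card_below_pathD W W' : #|W| = k -> #|W'| = k ->
  #|below_path W :\: below_path W'|
  = \sum_(t < (m + k).+1) (prefix_count W t - prefix_count W' t).
Proof.
move=> cW cW'; pose diag (p : 'I_m * 'I_k) := p.2 + m - p.1.
have diagP p : diag p < (m + k).+1.
  by rewrite /diag; have := ltn_ord p.2; lia.
rewrite -sum1_card (partition_big (fun p => Ordinal (diagP p)) xpredT) //=.
apply: eq_bigr => t _; have let' : t <= m + k by rewrite -ltnS.
have [ct ck _] := prefix_count_bounds W let'.
have [_ _ cm] := prefix_count_bounds W' let'.
rewrite sum1dep_card; set S := [set p | _].
have inj2 : {in S &, injective snd}.
  move=> [i j] [i' j']; rewrite !inE -!val_eqE /diag /=.
  case/andP=> _ /eqP et /andP[_ /eqP et'] ej; rewrite ej in et *.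
  congr pair; apply: val_inj => /=.
  have := ltn_ord i; have := ltn_ord i'; lia.
rewrite -(card_in_imset inj2) -(@card_ord_interval k);
  last exact: leq_trans ck (eq_leq cW).
apply: eq_card => j; rewrite inE; apply/imsetP/idP.
  case=> -[i j'] + ->; rewrite !inE -val_eqE /= -/(diag (i, j')) => /andP[+ /eqP <-].
  by rewrite -leqNgt.
(* The bounds [ct] and [cm] give [j < t <= j + m], so every column of the interval meets the
   diagonal in an actual cell. *)
move=> /andP[le1 lt2]; have ltj := ltn_ord j.
have lti : j + m - t < m by lia.
exists (Ordinal lti, j) => //; rewrite !inE -val_eqE /diag /=.
have -> : j + m - (j + m - t) = t by lia.
by rewrite -leqNgt le1 lt2 eqxx.
Qed.

Lemma symdiff_below_path W W' : #|W| = k -> #|W'| = k ->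
  symdiff (below_path W) (below_path W')
  = \sum_(t < (m + k).+1) ((prefix_count W t - prefix_count W' t)
                           + (prefix_count W' t - prefix_count W t)).
Proof. by move=> cW cW'; rewrite /symdiff !card_below_pathD // big_split. Qed.

Lemma below_path_inj W W' : #|W| = k -> #|W'| = k ->
  below_path W = below_path W' -> W = W'.
Proof.
move=> cW cW' eqW; have : symdiff (below_path W) (below_path W') == 0.
  by rewrite symdiff_eq0 eqW.
rewrite symdiff_below_path // sum_nat_eq0 => /forallP e0.
apply: prefix_count_inj => t; rewrite -ltnS => lett.
by have := e0 (Ordinal lett); rewrite /= addn_eq0; lia.
Qed.

Definition column_height (A : {set 'I_m * 'I_k}) (j : 'I_k) :=
  #|[set i | (i, j) \in A]|.

Lemma right_step_subproof (A : {set 'I_m * 'I_k}) (j : 'I_k) :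
  j + (m - column_height A j) < m + k.
Proof. by have := ltn_ord j; lia. Qed.

(* Column j has its top edge at height [column_height A j], so the j-th right
   step comes after j right steps and m - height down steps. *)
Definition right_step (A : {set 'I_m * 'I_k}) (j : 'I_k) : 'I_(m + k) :=
  Ordinal (right_step_subproof A j).

Definition path_of (A : {set 'I_m * 'I_k}) : {set 'I_(m + k)} :=
  [set right_step A j | j : 'I_k].

Section PathOf.
Variable A : {set 'I_m * 'I_k}.
Hypothesis idA : is_order_ideal (@grid_le m k) A.

Lemma mem_column_height i j : ((i, j) \in A) = (i < column_height A j).
Proof.
rewrite -mem_initial_segment ?inE // => x y leyx; rewrite !inE.
by have /idealP := idA; apply; rewrite /grid_le /= leyx leqnn.
Qed.

Lemma right_step_lt (j j' : 'I_k) : j < j' -> right_step A j < right_step A j'.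
Proof.
move=> ltj /=; suff : column_height A j' <= column_height A j by lia.
apply/subset_leq_card/subsetP => i; rewrite !inE.
by have /idealP := idA; apply; rewrite /grid_le /= leqnn ltnW.
Qed.

Lemma right_step_inj : injective (right_step A).
Proof.
move=> j j' eqj; apply: val_inj; case: (ltngtP j j') => // /right_step_lt;
  by rewrite eqj ltnn.
Qed.

Lemma card_path_of : #|path_of A| = k.
Proof. by rewrite card_imset ?card_ord //; apply: right_step_inj. Qed.

(** Right steps occur in column order, so those before time [t] come from an initial segment of
    columns. Thus [j] is below the count iff [right_step A j < t], that is, iff
    [i < column_height A j]. *)
Lemma path_ofK : below_path (path_of A) = A.
Proof.
apply/setP => -[i j]; rewrite mem_column_height inE /=.
set t := j + m - i.
have -> : prefix_count (path_of A) t = #|[set j' | right_step A j' < t]|.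
  rewrite -(card_imset _ right_step_inj); apply: eq_card => s; rewrite inE.
  apply/andP/imsetP => [[/imsetP[j' _ ->] lt]|[j' + ->]].
    by exists j'; rewrite ?inE.
  by rewrite inE => lt; split=> //; apply: imset_f.
rewrite -mem_initial_segment => [|x y leyx].
  rewrite inE /= /t; have := ltn_ord i; have := max_card [set i' | (i', j) \in A].
  by rewrite card_ord -/(column_height A j); lia.
rewrite !inE => /(leq_ltn_trans _); apply.
move: leyx; rewrite leq_eqVlt => /orP[/eqP/val_inj -> //|/right_step_lt].
exact: ltnW.
Qed.
End PathOf.

(** Ideals correspond bijectively to paths with [k] right steps; the condition on [#|W|] singles out
    the [W] recovered by [path_of]. *)
Lemma sum_Jgrid (F : {set 'I_m * 'I_k} -> nat) :
  \sum_(A : Jgrid m k) F (val A)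
  = \sum_(W : {set 'I_(m + k)} | #|W| == k) F (below_path W).
Proof.
rewrite (reindex_onto (fun W => (Sub _ (below_path_ideal W) : Jgrid m k))
           (fun A => path_of (val A))) /=; last first.
  by move=> A _; apply: val_inj; apply: path_ofK (valP A).
apply: eq_bigl => W; apply/eqP/eqP => [<-|cW].
  exact: card_path_of (below_path_ideal W).
have idW := below_path_ideal W.
by apply: below_path_inj => //; [exact: card_path_of|exact: path_ofK].
Qed.

Lemma sum_prefix_count t (F : nat -> nat) : t <= m + k ->
  \sum_(W : {set 'I_(m + k)} | #|W| == k) F (prefix_count W t)
  = \sum_(a < k.+1) 'C(t, a) * 'C(m + k - t, k - a) * F a.
Proof.
move=> letn; pose c W : 'I_k.+1 := inord (prefix_count W t).
rewrite (partition_big c xpredT) //=; apply: eq_bigr => a _.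
have leak : a <= k by rewrite -ltnS.
rewrite -card_prefix_count // -sum1dep_card big_distrl /=.
have cE W : #|W| == k -> (c W == a) = (prefix_count W t == a).
  move=> /eqP cW; rewrite -val_eqE /= inordK // ltnS.
  by have [_ + _] := prefix_count_bounds W letn; rewrite cW.
apply: eq_big => [W|W /andP[cW]].
  by have [/cE->|] := boolP (#|W| == k).
by rewrite cE // => /eqP->; rewrite mul1n.
Qed.

Lemma grid_le_refl : reflexive (@grid_le m k).
Proof. by move=> p; rewrite /grid_le !leqnn. Qed.

Lemma grid_le_anti : antisymmetric (@grid_le m k).
Proof.
move=> [i j] [i' j']; rewrite /grid_le /= => h.
by congr pair; apply: val_inj => /=; lia.
Qed.

Lemma grid_le_trans : transitive (@grid_le m k).
Proof. by move=> p q r; rewrite /grid_le; lia. Qed.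

Theorem dP_path_sum :
  dP m k = 2 * \sum_(t < (m + k).+1) \sum_(a < k.+1) \sum_(b < k.+1)
    'C(t, a) * 'C(m + k - t, k - a) * ('C(t, b) * 'C(m + k - t, k - b) * (b - a)).
Proof.
rewrite /dP /poset_wiener /wiener.
under eq_bigr => A _ do under eq_bigr => B _ do
  rewrite (gdist_ideal grid_le_refl grid_le_anti grid_le_trans).
under eq_bigr => A _ do rewrite (sum_Jgrid (symdiff (val A))).
rewrite (sum_Jgrid (fun A =>
  \sum_(W : {set 'I_(m + k)} | #|W| == k) symdiff A (below_path W))).
pose G W W' t := prefix_count W' t - prefix_count W t.
pose T := \sum_(W : {set 'I_(m + k)} | #|W| == k)
  \sum_(W' : {set 'I_(m + k)} | #|W'| == k)
   \sum_(t < (m + k).+1) G W W' t.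
(* The two truncated differences that make up an absolute value contribute equally, by exchanging
   [W] and [W']. *)
transitivity (T + T).
  rewrite {1}/T [X in _ = X + _]exchange_big -big_split; apply: eq_bigr => W /eqP cW.
  rewrite -big_split; apply: eq_bigr => W' /eqP cW'.
  by rewrite symdiff_below_path // -big_split.
rewrite addnn -mul2n; congr (2 * _); rewrite /T.
under eq_bigr => W _ do rewrite exchange_big.
rewrite exchange_big; apply: eq_bigr => t _.
have let' : t <= m + k by rewrite -ltnS.
under eq_bigr => W _ do
  rewrite (sum_prefix_count (fun b => b - prefix_count W t) let').
rewrite (sum_prefix_count (fun a => \sum_(b < k.+1)
  'C(t, b) * 'C(m + k - t, k - b) * (b - a)) let').
by apply: eq_bigr => a _; rewrite big_distrr.
Qed.
End GridIdeals.

(** * Sorting the path sum by the gap [d] *)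

(** Pairs of paths of length [i + j + d]: one with [i + d] down and [j] right steps, the other with
    [i] down and [j + d] right steps. *)
Definition pair_coef (d i j : nat) : nat :=
  'C(i + j + d, i + d) * 'C(i + j + d, i).

Lemma sum_shift (F : nat -> nat) n a c :
    a + c <= n -> (forall t, t <= n -> t < a \/ a + c < t -> F t = 0) ->
  \sum_(t < n.+1) F t = \sum_(i < c.+1) F (i + a).
Proof.
move=> len F0; rewrite -(big_mkord xpredT F) (@big_cat_nat _ _ _ a) //=; last by lia.
rewrite big_nat big1 ?add0n => [|t /andP[_ lta]]; last by rewrite F0 //; lia.
rewrite (@big_cat_nat _ _ _ (a + c).+1) //=; try lia.
rewrite [X in _ + X]big_nat [X in _ + X]big1 ?addn0 => [|t /andP[lta ltn]]; last first.
  by rewrite F0 //; lia.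
rewrite -{1}[a]add0n big_addn big_mkord.
by have -> : (a + c).+1 - a = c.+1 by lia.
Qed.

(** Substitute [b = a + d], [j = a] and [t = i + a + d]; the halves before and after [t] each give
    one [pair_coef]. The bound [N] is left free so that one partial sum can serve many pairs [m],
    [k]. *)
Lemma path_sum_by_gap m k N : m + k <= N ->
  \sum_(t < (m + k).+1) \sum_(a < k.+1) \sum_(b < k.+1)
    'C(t, a) * 'C(m + k - t, k - a) * ('C(t, b) * 'C(m + k - t, k - b) * (b - a))
  = \sum_(d < N.+1 | (d <= m) && (d <= k)) d *
      \sum_(i < (m - d).+1) \sum_(j < (k - d).+1)
        pair_coef d i j * pair_coef d (m - d - i) (k - d - j).
Proof.
move=> leN; pose H t a d := d * ('C(t, a) * 'C(m + k - t, k - a)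
                              * ('C(t, a + d) * 'C(m + k - t, k - (a + d)))).
transitivity (\sum_(t < (m + k).+1) \sum_(a < k.+1) \sum_(d < N.+1 | a + d <= k) H t a d).
  apply: eq_bigr => t _; apply: eq_bigr => a _; have lea := ltn_ord a.
  pose F b := 'C(t, a) * 'C(m + k - t, k - a)
                * ('C(t, b) * 'C(m + k - t, k - b) * (b - a)).
  rewrite (@sum_shift F k a (k - a)); [|by lia|]; last first.
    move=> b leb [ltb|ltb]; last by lia.
    by rewrite /F (eqP (ltnW ltb : b - a == 0)) !muln0.
  rewrite (big_ord_widen N.+1 (fun d => F (d + a))); last by lia.
  apply: eq_big => [d|d _]; first by lia.
  by rewrite /H /F addnK [d + a]addnC; lia.
under eq_bigr => t _ do rewrite (exchange_big_dep xpredT) //=.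
rewrite exchange_big /= [RHS]big_mkcond; apply: eq_bigr => d _.
rewrite (exchange_big_dep (fun a : 'I_k.+1 => a + d <= k)) //=.
have [ledk|ltkd] := leqP d k; last first.
  by rewrite andbF big1 // => a; lia.
(* Outside this range of [t], one path needs more right steps than the time before, or after, the
   cut allows. *)
rewrite andbT; have H0 t a : t <= m + k -> a + d <= k -> t < a + d \/ m + a < t ->
    H t a d = 0.
  move=> let' lead [ltt|ltt]; rewrite /H.
    by rewrite (bin_small ltt) !(mul0n, muln0).
  by rewrite (@bin_small _ (k - a)) ?(mul0n, muln0) //; lia.
have [ledm|ltmd] := leqP d m; last first.
  rewrite big1 // => a lead; rewrite big1 // => t _.
  by apply: H0 => //; [rewrite -ltnS|lia].
rewrite exchange_big /= big_distrr /=.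
rewrite (big_ord_widen k.+1 (fun j => d * \sum_(i < (m - d).+1)
  pair_coef d i j * pair_coef d (m - d - i) (k - d - j))); last by lia.
apply: eq_big => [a|a lead]; first by lia.
transitivity (\sum_(i < (m - d).+1) H (i + (a + d)) a d).
  rewrite lead; apply: (@sum_shift (fun t => H t a d)) => [|t let' ht]; first by lia.
  by rewrite H0 //; lia.
rewrite big_distrr; apply: eq_bigr => i _ /=.
have lei := ltn_ord i.
rewrite /H /pair_coef; congr (_ * _).
have -> : m + k - (i + (a + d)) = m - d - i + (k - d - a) + d by lia.
(* [pair_coef] chooses the down steps and [H] the right steps; symmetry of binomials converts one
   into the other. *)
rewrite addnA -(@bin_sub (i + a + d) (i + d)); last by lia.
rewrite -(@bin_sub (i + a + d) i); last by lia.
rewrite -(@bin_sub (m - d - i + (k - d - a) + d) (m - d - i + d)); last by lia.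
rewrite -(@bin_sub (m - d - i + (k - d - a) + d) (m - d - i)); last by lia.
have -> : i + a + d - (i + d) = a by lia.
have -> : i + a + d - i = a + d by lia.
have -> : m - d - i + (k - d - a) + d - (m - d - i + d) = k - (a + d) by lia.
have -> : m - d - i + (k - d - a) + d - (m - d - i) = k - a by lia.
by rewrite mulnCA mulnA [RHS]mulnCA mulnA; lia.
Qed.

(** * Power series *)

Local Open Scope ring_scope.

(** A separate name for the function type, to carry the convolution product; [pseries (pseries int)]
    unfolds to [fps]. *)
Definition pseries (R : Type) := nat -> R.

HB.instance Definition _ (R : Type) := gen_eqMixin (pseries R).
HB.instance Definition _ (R : Type) := gen_choiceMixin (pseries R).

Section SeriesZmod.
Variable R : zmodType.
Implicit Types f g h : pseries R.

Definition series_add f g : pseries R := fun n => f n + g n.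
Definition series_opp f : pseries R := fun n => - f n.
Definition series_zero : pseries R := fun=> 0.

Lemma series_addA : associative series_add.
Proof. by move=> f g h; apply/funext => n; apply: addrA. Qed.
Lemma series_addC : commutative series_add.
Proof. by move=> f g; apply/funext => n; apply: addrC. Qed.
Lemma series_add0 : left_id series_zero series_add.
Proof. by move=> f; apply/funext => n; apply: add0r. Qed.
Lemma series_addN : left_inverse series_zero series_opp series_add.
Proof. by move=> f; apply/funext => n; apply: addNr. Qed.

HB.instance Definition _ :=
  GRing.isZmodule.Build (pseries R) series_addA series_addC series_add0 series_addN.

Lemma seriesD f g n : (f + g) n = f n + g n. Proof. by []. Qed.
Lemma seriesN f n : (- f) n = - f n. Proof. by []. Qed.
Lemma seriesMn f j n : (f *+ j) n = f n *+ j.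
Proof. by elim: j => // j IH; rewrite !mulrS seriesD IH. Qed.
Lemma series_sum (I : Type) (r : seq I) (P : pred I) (F : I -> pseries R) n :
  (\sum_(i <- r | P i) F i) n = \sum_(i <- r | P i) F i n.
Proof. by elim/big_rec2: _ => // i a f _ <-. Qed.
End SeriesZmod.

Section SeriesRing.
Variable R : comNzRingType.
Implicit Types f g h : pseries R.

Definition series_mul f g : pseries R :=
  fun n => \sum_(i < n.+1) f i * g (n - i)%N.
Definition series_one : pseries R := fun n => (n == 0%N)%:R.

(** Coefficient [n] of a product depends only on coefficients up to [n], so commutativity and
    associativity are inherited from truncations to polynomials. *)
Let trunc N f : {poly R} := \poly_(i < N) f i.

Let coef_trunc N f n : (n < N)%N -> (trunc N f)`_n = f n.
Proof. by move=> ltnN; rewrite coef_poly ltnN. Qed.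

Let coef_truncM N f g n :
  (n < N)%N -> (trunc N f * trunc N g)`_n = series_mul f g n.
Proof.
move=> ltnN; rewrite coefM; apply: eq_bigr => i _.
have lein := ltn_ord i; rewrite !coef_trunc //; lia.
Qed.

Lemma series_mulC : commutative series_mul.
Proof.
by move=> f g; apply/funext => n; rewrite -!(coef_truncM _ _ (ltnSn n)) mulrC.
Qed.

Lemma series_mulA : associative series_mul.
Proof.
move=> f g h; apply/funext => n.
have truncM p q j : (j <= n)%N ->
    (trunc n.+1 (series_mul p q))`_j = (trunc n.+1 p * trunc n.+1 q)`_j.
  by move=> lejn; rewrite coef_trunc // coef_truncM.
rewrite -!(coef_truncM _ _ (ltnSn n)).
transitivity (trunc n.+1 f * (trunc n.+1 g * trunc n.+1 h))`_n.
  by rewrite coefM [RHS]coefM; apply: eq_bigr => i _; rewrite truncM ?leq_subr.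
rewrite mulrA coefM [RHS]coefM; apply: eq_bigr => i _.
by rewrite truncM // -ltnS.
Qed.

Lemma series_mul1 : left_id series_one series_mul.
Proof.
move=> f; apply/funext => n; rewrite /series_mul big_ord_recl /= mul1r subn0.
by rewrite big1 ?addr0 // => i _; rewrite mul0r.
Qed.

Lemma series_mulDl : left_distributive series_mul (@GRing.add (pseries R)).
Proof.
move=> f g h; apply/funext => n; rewrite seriesD -big_split /=.
by apply: eq_bigr => i _; rewrite mulrDl.
Qed.

Lemma series_one_neq0 : series_one != 0.
Proof.
by apply/eqP => /(congr1 (@^~ 0%N)) /eqP; rewrite /series_one oner_eq0.
Qed.

HB.instance Definition _ := GRing.Zmodule_isComNzRing.Build (pseries R)
  series_mulA series_mulC series_mul1 series_mulDl series_one_neq0.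

Lemma seriesM f g n : (f * g) n = \sum_(i < n.+1) f i * g (n - i)%N.
Proof. by []. Qed.

Definition series_const (a : R) : pseries R := fun n => a *+ (n == 0%N).
Definition series_var : pseries R := fun n => (n == 1%N)%:R.

Lemma series_constM a f n : (series_const a * f) n = a * f n.
Proof.
rewrite seriesM big_ord_recl subn0 big1 ?addr0 // => i _.
by rewrite /series_const mulr0n mul0r.
Qed.

Lemma series_varM0 f : (series_var * f) 0%N = 0.
Proof. by rewrite seriesM big_ord1 mul0r. Qed.

Lemma series_varMS f n : (series_var * f) n.+1 = f n.
Proof.
rewrite seriesM big_ord_recl mul0r add0r big_ord_recl mul1r big1 => [|i _].
  by rewrite addr0 /= subSS subn0.
by rewrite mul0r.
Qed.

Definition vanish N f := forall n, (n < N)%N -> f n = 0.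

Lemma vanishM N M f g : vanish N f -> vanish M g -> vanish (N + M) (f * g).
Proof.
move=> f0 g0 n ltn; rewrite seriesM big1 // => i _.
have [/f0->|leNi] := ltnP i N; first by rewrite mul0r.
by rewrite g0 ?mulr0 //; have := ltn_ord i; lia.
Qed.

Lemma vanishMr N f g : vanish N f -> vanish N (f * g).
Proof. by move=> f0; rewrite -[N]addn0; apply: vanishM. Qed.

Lemma vanishX f N : vanish 1 f -> vanish N (f ^+ N).
Proof.
by move=> f0; elim: N => // N IH; rewrite exprS -add1n; apply: vanishM.
Qed.
End SeriesRing.

(** * Consequences of the three-term recurrence in an abstract commutative ring *)

Section ThreeTerm.
Variables (S : comNzRingType) (s q : S) (B : nat -> S).
Hypothesis B0 : s * B 0%N = 1 + 2%:R * q * B 1%N.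
Hypothesis BS : forall d, s * B d.+1 = B d + q * B d.+2.
Hypothesis q_sep : forall z, (forall n, exists w, z = q ^+ n * w) -> z = 0.

(** Reduces an equation that follows from a known one to a polynomial identity for [ring]. *)
Let eq_transport (u v x y : S) : u = v -> x - y = u - v -> x = y.
Proof. by move=> -> /eqP; rewrite subrr subr_eq0 => /eqP. Qed.

(* By the recurrence, the defect B_{d+1}^2 - B_d B_{d+2} is q times the next
   one, hence divisible by every power of q. *)
Lemma geometric_ratio d : B d.+1 ^+ 2 = B d * B d.+2.
Proof.
pose E j := B j.+1 ^+ 2 - B j * B j.+2.
have ES j : E j = q * E j.+1.
  have : s * B j.+2 * B j.+1 = s * B j.+1 * B j.+2 by ring.
  by rewrite !BS /E => /eq_transport; apply; ring.
apply/eqP; rewrite -subr_eq0; apply/eqP/q_sep => n; exists (E (d + n)%N).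
elim: n => [|n IH]; first by rewrite mul1r addn0.
by rewrite [LHS]IH ES addnS exprSr mulrA.
Qed.

(** Computing [s * B 0 * B 1] by both recurrences gives [B 0 ^+ 2 = B 1 + q * B 1 ^+ 2], which is
    what remains after squaring [s * B 0 = 1 + 2 * q * B 1]. *)
Lemma central_term : (s ^+ 2 - 4%:R * q) * B 0%N ^+ 2 = 1.
Proof.
have e0 := geometric_ratio 0; have e1 : B 0%N ^+ 2 = B 1%N + q * B 1%N ^+ 2.
  have : s * B 1%N * B 0%N = s * B 0%N * B 1%N by ring.
  rewrite BS B0 mulrDl -mulrA [B 2%N * _]mulrC -e0 => /eq_transport; apply.
  by ring.
have -> : (s ^+ 2 - 4%:R * q) * B 0%N ^+ 2
  = (s * B 0%N) ^+ 2 - 4%:R * q * B 0%N ^+ 2 by ring.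
by rewrite B0 e1; ring.
Qed.

Let b d := q ^+ d * B d ^+ 2.

(** Square the recurrence for [s * B d.+1]; the cross term [2 * q * B d * B d.+2] is
    [2 * q * B d.+1 ^+ 2] by [geometric_ratio]. *)
Lemma second_difference d :
  (s ^+ 2 - 4%:R * q) * b d.+1 = q * (b d - 2%:R * b d.+1 + b d.+2).
Proof.
rewrite /b.
have -> : (s ^+ 2 - 4%:R * q) * (q ^+ d.+1 * B d.+1 ^+ 2)
  = q ^+ d.+1 * ((s * B d.+1) ^+ 2 - 4%:R * q * B d.+1 ^+ 2) by ring.
by rewrite BS geometric_ratio !exprS; ring.
Qed.

(** Summation by parts leaves [b 0], evaluated by [central_term], and a boundary term divisible by
    [q ^+ N.+1], which is invisible in low degree. *)
Lemma weighted_sum N :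
  (s ^+ 2 - 4%:R * q) ^+ 2 * \sum_(d < N.+1) d%:R * b d
  = q + q ^+ N.+1 * ((s ^+ 2 - 4%:R * q) *
         (N%:R * q * B N.+1 ^+ 2 - N.+1%:R * B N ^+ 2)).
Proof.
have sumE : (s ^+ 2 - 4%:R * q) * \sum_(d < N.+1) d%:R * b d
    = q * (b 0%N - N.+1%:R * b N + N%:R * b N.+1).
  elim: N => [|N IH]; first by rewrite big_ord1 /=; ring.
  rewrite big_ord_recr mulrDr IH /= [X in _ + X](mulrCA _ N.+1%:R).
  by rewrite second_difference -[N.+2%:R]natr1 -[N.+1%:R]natr1; ring.
rewrite expr2 -mulrA sumE.
have := congr1 ( *%R q) central_term => /eq_transport; apply.
by rewrite /b !exprS; ring.
Qed.
End ThreeTerm.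

(** * The pair series in two variables; the outer index is the exponent of x *)

Notation series2 := (pseries (pseries int)).

Definition varX : series2 := series_var _.
Definition varY : series2 := series_const (series_var _).
Definition pair_series (d : nat) : series2 := fun i j => (pair_coef d i j)%:Z.

Lemma varX_coef (f : series2) i j :
  (varX * f) i j = if i is i'.+1 then f i' j else 0.
Proof. by case: i => [|i]; rewrite ?series_varM0 ?series_varMS. Qed.

Lemma varY_coef (f : series2) i j :
  (varY * f) i j = if j is j'.+1 then f i j' else 0.
Proof.
by rewrite series_constM; case: j => [|j]; rewrite ?series_varM0 ?series_varMS.
Qed.

Lemma varXY_coef (f : series2) d i j : ((varX * varY) ^+ d * f) i j
  = if ((d <= i) && (d <= j))%N then f (i - d)%N (j - d)%N else 0.
Proof.
elim: d i j => [|d IH] i j; first by rewrite mul1r !subn0.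
rewrite exprS -!mulrA varX_coef; case: i => // i; rewrite varY_coef.
by case: j => [|j]; rewrite ?andbF // IH !subSS !ltnS.
Qed.

Lemma vanish_varXY N (f : series2) : vanish N ((varX * varY) ^+ N * f).
Proof.
by apply/vanishMr/vanishX/vanishMr => -[].
Qed.

Lemma pair_series0_rec :
  (1 - varX - varY) * pair_series 0
  = 1 + 2%:R * (varX * varY) * pair_series 1.
Proof.
rewrite !mulrBl mul1r -!mulrA mulr_natl; apply/funext => i; apply/funext => j.
rewrite !(seriesD, seriesN, seriesMn) !(varX_coef, varY_coef) /pair_series.
case: i => [|i]; case: j => [|j]; rewrite ?varY_coef /pair_coef.
- by [].
- by rewrite !addn0 !add0n !bin0.
- by rewrite !addn0 !binn.
rewrite !addn0 !addn1 !addSn !addnS !(binS (i + j).+1).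
have -> : (1 : series2) i.+1 j.+1 = 0 by [].
ring.
Qed.

(** Pascal's rule on both factors removes the last step of each path. Equal last steps give the
    terms with [varX] and [varY] on the left; different ones leave a gap of [d] or [d.+2]. *)
Lemma pair_series_rec d :
  (1 - varX - varY) * pair_series d.+1
  = pair_series d + (varX * varY) * pair_series d.+2.
Proof.
rewrite !mulrBl mul1r -!mulrA; apply/funext => i; apply/funext => j.
rewrite !(seriesD, seriesN) !(varX_coef, varY_coef) /pair_series.
case: i => [|i]; case: j => [|j]; rewrite ?varY_coef /pair_coef.
- by rewrite !add0n !binn !bin0.
- by rewrite !add0n !bin0 !addSn !addnS (binS (j + d).+1); ring.
- by rewrite !addn0 !addSn !addnS !binn (binS (i + d).+1); ring.
- by rewrite !addSn !addnS !(binS (i + j + d).+2); ring.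
Qed.

Lemma varXY_separated (z : series2) :
  (forall n, exists w, z = (varX * varY) ^+ n * w) -> z = 0.
Proof.
by move=> zE; apply/funext => i; have [w ->] := zE i.+1; apply: vanish_varXY.
Qed.

Lemma Qden_series :
  (Qden : series2) = (1 - varX - varY) ^+ 2 - 4%:R * (varX * varY).
Proof.
(* The factors [1] put every monomial in the form to which [varX_coef] and [varY_coef] apply. *)
have -> : (1 - varX - varY) ^+ 2 - 4%:R * (varX * varY)
  = 1 - (varX * 1) *+ 2 - (varY * 1) *+ 2 + varX * (varX * 1)
    - (varX * (varY * 1)) *+ 2 + varY * (varY * 1) by ring.
apply/funext => i; apply/funext => j.
rewrite !(seriesD, seriesN, seriesMn) !(varX_coef, varY_coef).
by case: i => [|[|[|i]]]; case: j => [|[|[|j]]]; rewrite ?(varX_coef, varY_coef).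
Qed.

Lemma Nnum_series : (Nnum : series2) = 2%:R * (varX * varY).
Proof.
have -> : 2%:R * (varX * varY) = (varX * (varY * 1)) *+ 2 by ring.
apply/funext => i; apply/funext => j; rewrite !seriesMn varX_coef.
by case: i => [|[|i]]; case: j => [|[|j]]; rewrite ?varY_coef.
Qed.

Lemma fps_mulE (f g : series2) : fps_mul f g = f * g.
Proof.
apply/funext => m; apply/funext => k; rewrite seriesM series_sum.
by apply: eq_bigr => i _; rewrite seriesM.
Qed.

Lemma dP_series m k N : (m + k <= N)%N ->
  (dP m k)%:Z = (2%:R * \sum_(d < N.+1) d%:R *
                  ((varX * varY) ^+ d * pair_series d ^+ 2)) m k.
Proof.
move=> leN; rewrite dP_path_sum (path_sum_by_gap leN) mulr_natl !seriesMn.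
rewrite !series_sum PoszM -mulr_natl natz; congr (_ * _).
rewrite (big_morph Posz PoszD (erefl _)) big_mkcond; apply: eq_bigr => d _.
rewrite mulr_natl !seriesMn varXY_coef; case: ifP => _; last by rewrite mul0rn.
rewrite PoszM -mulr_natl natz; congr (_ * _).
rewrite expr2 seriesM series_sum (big_morph Posz PoszD (erefl _)).
apply: eq_bigr => i _; rewrite seriesM (big_morph Posz PoszD (erefl _)).
by apply: eq_bigr => j _; rewrite PoszM.
Qed.

(* Since Q has constant term 1 it is invertible in Z[[x,y]], so
   Dgen = 2xy / Q^2  <->  Dgen * Q * Q = 2xy  (coefficientwise). *)
Theorem theorem1p1 :
  forall m k : nat, fps_mul (fps_mul Dgen Qden) Qden m k = Nnum m k.
Proof.
move=> m k; rewrite !fps_mulE -mulrA -expr2 -fps_mulE.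
pose T := \sum_(d < (m + k).+1) d%:R * ((varX * varY) ^+ d * pair_series d ^+ 2).
(* Only coefficients with [i <= m] and [j <= k] enter, and all of them are read off the same partial
   sum [T]. *)
transitivity (fps_mul (2%:R * T) ((Qden : series2) ^+ 2) m k).
  apply: eq_bigr => i _; apply: eq_bigr => j _; congr (_ * _).
  by rewrite /Dgen (@dP_series _ _ (m + k)) //; have := ltn_ord i; have := ltn_ord j; lia.
rewrite fps_mulE mulrC mulrCA Qden_series.
rewrite (weighted_sum pair_series0_rec pair_series_rec varXY_separated).
rewrite mulrDr -Nnum_series seriesD mulrCA seriesD.
(* The boundary term is divisible by the power [m + k + 1] of xy, hence has no coefficient at
   x-degree [m]. *)
by rewrite vanish_varXY ?addr0 // ltnS leq_addr.
Qed.
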